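(* Let $\Gamma$ be a finite simple graph with structural equivalence classes $C_1,\dots,C_{s}$ (where $s=s(\Gamma)$), and let $\gamma_i=|C_i|$. For each $i$, let $S_{\gamma_i,i}$ denote the group of all permutations of $V(\Gamma)$ that fix every vertex outside $C_i$ (a copy of the symmetric group on $C_i$). Then \[ SEP(\Gamma)=\Big\langle \bigcup_{i=1}^{s} S_{\gamma_i,i}\Big\rangle \cong \prod_{i=1}^{s} S_{\gamma_i,i}, \] and $|SEP(\Gamma)|=\prod_{i=1}^{s}\gamma_i!$.
   Context: Two vertices $u,v$ of a graph $\Gamma$ are structurally equivalent if the transposition $(u\,v)$ (swapping $u,v$ and fixing all other vertices) is an automorphism of $\Gamma$ (a vertex is considered structurally equivalent to itself). Structural equivalence is an equivalence relation on $V(\Gamma)$; its classes are the structural equivalence classes, and $s(\Gamma)$ denotes their number. The structural equivalence permutation group is $SEP(\Gamma)=\langle\{(u\,v) : (u\,v)\in \mathrm{Aut}(\Gamma)\}\rangle$, a subgroup of the symmetric group on $V(\Gamma)$. *)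

(* Defs.v *)
From HB Require Import structures.
From mathcomp Require Import all_boot all_fingroup.

Set Implicit Arguments.
Unset Strict Implicit.
Unset Printing Implicit Defensive.

Local Open Scope group_scope.

(* A finite simple graph on T is a symmetric irreflexive e : rel T. *)
Section StructuralEquivalence.

Variables (T : finType) (e : rel T).

Definition graph_aut : {set {perm T}} :=
  [set s : {perm T} | [forall x, forall y, e (s x) (s y) == e x y]].

Lemma graph_aut_group_set : group_set graph_aut.
Proof.
apply/group_setP; split=> [|s t].
  by rewrite inE; apply/forallP=> x; apply/forallP=> y; rewrite !perm1.
rewrite !inE => /'forall_'forall_eqP es /'forall_'forall_eqP et.
by apply/'forall_'forall_eqP => x y; rewrite !permM et es.
Qed.

Canonical graph_aut_group := Group graph_aut_group_set.

(* tperm u u = 1, so this relation is reflexive. *)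
Definition struct_equiv : rel T := [rel u v | tperm u v \in graph_aut].

Definition se_classes : {set {set T}} :=
  equivalence_partition struct_equiv [set: T].

Definition se_number : nat := #|se_classes|.

Definition SEP : {set {perm T}} :=
  <<[set tperm u v | u in T, v in T & tperm u v \in graph_aut]>>.

Canonical SEP_group := [group of SEP].

End StructuralEquivalence.

(* Main.v *)
Require Import Defs.
From HB Require Import structures.
From mathcomp Require Import all_boot all_fingroup.

Set Implicit Arguments.
Unset Strict Implicit.
Unset Printing Implicit Defensive.

Local Open Scope group_scope.

(* Transpositions in a group of permutations conjugate each other, so
   structural equivalence is an equivalence relation and the transpositions
   generating SEP are exactly those exchanging two points of a common class;
   they generate the symmetric groups on the classes. Symmetric groups on
   disjoint sets commute and meet trivially, hence generate their direct
   product. *)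

Lemma tperm_Sym (T : finType) (S : {set T}) u v :
  u \in S -> v \in S -> tperm u v \in Sym S.
Proof.
move=> uS vS; rewrite inE; apply: subset_trans (tperm_on u v) _.
by rewrite subUset !sub1set uS.
Qed.

(** Induction on the number of moved points: if [s] moves [x], then [s * tperm x (s x)] fixes [x]
    and still fixes every fixed point of [s]. *)
Lemma Sym_gen_tperm (T : finType) (S : {set T}) :
  Sym S = <<[set tperm u v | u in S, v in S]>>.
Proof.
apply/eqP; rewrite eqEsubset; apply/andP; split; last first.
  rewrite gen_subG; apply/subsetP => _ /imset2P[u v uS vS ->].
  exact: tperm_Sym.
apply/subsetP => s /[!inE].
have [n] := ubnP #|[pred x | s x != x]|; elim: n s => // n IHn s le_s sS.
have [x sx|fix_s] := pickP [pred x | s x != x]; last first.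
  suff -> : s = 1 by rewrite group1.
  by apply/permP => x; rewrite perm1; apply/eqP/negbFE; exact: fix_s.
have xS : x \in S by rewrite (subsetP sS).
have sxS : s x \in S by rewrite (perm_closed _ sS).
set t := tperm x (s x).
have tG : t \in <<[set tperm u v | u in S, v in S]>>.
  by rewrite mem_gen ?imset2_f.
have tS : perm_on S t by have := tperm_Sym xS sxS; rewrite inE.
rewrite -(groupMr _ tG); apply: IHn; last exact: perm_onM.
rewrite -ltnS; apply: leq_trans le_s; rewrite ltnS; apply: proper_card.
apply/properP; split; last first.
  by exists x => //; rewrite !inE permM tpermR eqxx.
apply/subsetP => y; rewrite !inE permM; apply: contraNneq => sy.
have xy : x != y by apply: contraNneq sx => ->; rewrite /= sy.
by rewrite sy tpermD // -sy (inj_eq perm_inj).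
Qed.

Lemma struct_equiv_equivalence (T : finType) (e : rel T) :
  equivalence_rel (struct_equiv e).
Proof.
apply/equivalence_relP; split=> [u | u v uv w].
  by rewrite /struct_equiv /= tperm1 group1.
rewrite /struct_equiv /= in uv *.
(* Conjugating [tperm u w] by [tperm u v] yields [tperm v w] only when [w] differs from both [u] and
   [v], so the coincidences are treated first. *)
have [<-|uw] := eqVneq u w; first by rewrite tperm1 group1 tpermC.
have [<-|vw] := eqVneq v w; first by rewrite tperm1 group1.
apply/idP/idP => [uwG | vwG].
  by rewrite -(tpermJ_tperm uw vw) groupJ.
by rewrite -(tpermJ_tperm vw uw) groupJ // tpermC.
Qed.

Lemma bigdprod_commute (gT : finGroupType) (I : finType) (F : I -> {group gT})
    (G : {group gT}) :
  \big[dprod/1]_i F i = G -> forall i j, i != j -> F j \subset 'C(F i).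
Proof.
move=> defG i j ij; rewrite (bigD1 i) // (bigD1 j) 1?eq_sym //= in defG.
have [[_ H _ defH] _ + _] := dprodP defG; rewrite defH; apply: subset_trans.
by have [[_ K _ ->] <- _ _] := dprodP defH; rewrite mulG_subl.
Qed.

(** Multiplying the coordinates together maps the external product onto the internal one;
    commutation of the factors makes this a morphism, unique factorization makes it injective. *)
Lemma bigdprod_isog_setXn (gT : finGroupType) (I : finType)
    (F : I -> {group gT}) (G : {group gT}) :
  \big[dprod/1]_i F i = G -> G \isog setXn (fun i => F i).
Proof.
move=> defG; have cF := bigdprod_commute defG.
pose f (x : {dffun I -> gT}) := \prod_i x i.
have fM : {in setXn (fun i => F i) &, {morph f : x y / x * y}}.
  move=> x y /setXnP xF /setXnP yF; rewrite /f.
  under eq_bigr do rewrite mulg_ffun.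
  have := index_enum_uniq I.
  elim: (index_enum I) => [|i r IHr]; first by rewrite !big_nil mulg1.
  move=> /= /andP[ir /IHr {}IHr]; rewrite !big_cons IHr.
  (* The index list has no repetition, so [y i] meets only factors of index other than [i] and can
     move past them. *)
  have cyx : commute (y i) (\prod_(j <- r) x j).
    rewrite big_seq; apply: commute_prod => j jr.
    have ji : j != i by apply: contraNneq ir => <-.
    exact: (centsP (cF j i ji)).
  by rewrite !mulgA; congr (_ * _); rewrite -!mulgA cyx.
rewrite isog_sym; apply/isogP; exists (Morphism fM).
  apply/injmP => x y xF yF /= eq_f.
  have fyG : f y \in G.
    rewrite -(bigdprodW defG); apply/prodsgP; exists y => // i _.
    by apply/setXnP: i.
  have [c [_ _ uniq_c]] := mem_bigdprod defG fyG.
  apply/ffunP => i; rewrite (uniq_c x) ?(uniq_c y) // => j _;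
    by move/setXnP: xF yF => xF /setXnP.
rewrite morphimEdom -(bigdprodW defG); apply/setP => z.
apply/imsetP/prodsgP => [[x /setXnP xF ->]|[c cF' ->]]; first by exists x.
exists (finfun c); first by apply/setXnP => i; rewrite ffunE cF'.
by rewrite /= /f; apply: eq_bigr => i _; rewrite ffunE.
Qed.

Lemma bigdprod_Sym (T I : finType) (C : I -> {set T}) :
    (forall i j, i != j -> [disjoint C i & C j]) ->
  \big[dprod/1]_i Sym (C i) = <<\bigcup_i Sym (C i)>>.
Proof.
move=> tiC.
(* The single inclusion in ['C(A) :\: A^#] says both that the other factors centralize [A] and that
   they meet it trivially. It is checked on the larger group [Sym (~: C i)], which contains all the
   other factors. *)
have /bigdprodYP/eqP : forall i, true ->
    (\prod_(j | true && (j != i)) Sym_group (C j))%G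
      \subset 'C(Sym_group (C i)) :\: (Sym_group (C i))^#.
  move=> i _; have /subset_trans -> // :
      (\prod_(j | j != i) Sym_group (C j))%G \subset Sym (~: C i).
    rewrite bigprodGE gen_subG; apply/bigcupsP => j ji.
    apply/subsetP => s; rewrite !inE => sC; apply: subset_trans sC _.
    by rewrite -disjoints_subset tiC.
  rewrite subsetD; apply/andP; split.
    apply/centsP => s; rewrite inE => sC t; rewrite inE => tC.
    by apply: (perm_onC sC tC); rewrite disjoints_subset.
  rewrite disjoint_sym disjoints_subset; apply/subsetP => s; rewrite !inE.
  case/andP=> s1 sC; apply: contraNN s1 => sC'; apply/eqP/permP => x.
  rewrite perm1; case: (boolP (x \in C i)) => xC.
    by rewrite (out_perm sC') // inE xC.
  exact: out_perm sC xC.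
by move=> /= ->; rewrite bigprodGE.
Qed.

Theorem theorem2p3 (T : finType) (e : rel T)
    (e_sym : symmetric e) (e_irr : irreflexive e)
    (C : 'I_(se_number e) -> {set T}) (C_inj : injective C)
    (C_classes : [set C i | i : 'I_(se_number e)] = se_classes e) :
  [/\ SEP e = << \bigcup_(i < se_number e) Sym (C i) >>,
      << \bigcup_(i < se_number e) Sym (C i) >>
        \isog setXn (fun i : 'I_(se_number e) => Sym (C i))
    & #|SEP e| = (\prod_(i < se_number e) (#|C i|)`!)%N].
Proof.
have eqvE := struct_equiv_equivalence e.
have eqvT : {in [set: T] & &, equivalence_rel (struct_equiv e)} by move=> *.
have partC := equivalence_partitionP eqvT.
have C_in i : C i \in se_classes e by rewrite -C_classes imset_f.
have tiC i j : i != j -> [disjoint C i & C j].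
  have /and3P[_ /trivIsetP tiC _] := partC.
  by move=> ij; apply: tiC; rewrite ?C_in // (inj_eq C_inj).
have defS : SEP e = <<\bigcup_i Sym (C i)>>.
  apply/eqP; rewrite eqEsubset !gen_subG; apply/andP; split.
    apply/subsetP => _ /imset2P[u v _ /[!inE] /= uv ->].
    (* A generator [tperm u v] lies in [Sym (C i)] for the class [C i] of [u], which also contains
       [v]. *)
    have : pblock (se_classes e) u \in se_classes e.
      by rewrite pblock_mem // (cover_partition partC).
    rewrite -{2}C_classes => /imsetP[i _ defCi].
    apply/mem_gen/bigcupP; exists i => //.
    rewrite Sym_gen_tperm mem_gen // imset2_f // -defCi.
      by rewrite mem_pblock (cover_partition partC).
    by rewrite pblock_equivalence_partition ?inE /struct_equiv /= ?inE.
  (* Conversely, two points of one class are structurally equivalent, so every transposition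
     generating [Sym (C i)] is a generator of [SEP e]. *)
  apply/bigcupsP => i _; rewrite Sym_gen_tperm genS //.
  apply/subsetP => _ /imset2P[u v uC vC ->]; rewrite imset2_f // inE /=.
  have /and3P[_ tiP _] := partC.
  rewrite -[_ \in _]/(struct_equiv e u v).
  rewrite -(pblock_equivalence_partition eqvT) ?inE //.
  by rewrite (def_pblock tiP (C_in i) uC).
have dprodC := bigdprod_Sym tiC.
split=> //; first exact: (bigdprod_isog_setXn (F := fun i => Sym_group (C i))).
rewrite defS -(bigdprod_card dprodC).
by apply: eq_bigr => i _; rewrite card_Sym.
Qed.
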